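(* Let $n\geq 4$ be an integer, let $\Pi$ and $\Pi'$ be projective spaces of dimension $n$, and let $f$ be a surjective map from the set of lines of $\Pi$ onto the set of lines of $\Pi'$ which maps intersecting lines to intersecting lines, i.e. for all lines $a,b$ of $\Pi$, $a\sim b$ implies $f(a)\sim f(b)$. Then $f$ is injective, and $f$ stems from a collineation of $\Pi$ onto $\Pi'$.
   Context: For lines $a,b$ of a projective space, $a\sim b$ means that $a$ and $b$ are different lines which have a point in common. A collineation of $\Pi$ onto $\Pi'$ is a bijection $\kappa$ from the points of $\Pi$ to the points of $\Pi'$ such that $\kappa$ and $\kappa^{-1}$ map lines onto lines; $f$ stems from $\kappa$ if $f(a)=\{\kappa(P) : P\in a\}$ for every line $a$ of $\Pi$ (lines being identified with their sets of points). *)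

(* Defs.v *)
From mathcomp Require Import all_boot.
From mathcomp Require Import mathcomp_extra boolp classical_sets functions.

Set Implicit Arguments.
Unset Strict Implicit.
Unset Printing Implicit Defensive.

Local Open Scope classical_set_scope.

(* [projspace_veblen] is the Veblen-Young axiom: if the lines xy and zt meet,
   then so do the lines xz and yt. *)
Record projspace := Projspace {
  points : Type;
  line : set (set points);
  projspace_join : forall x y : points, x <> y ->
    exists! a : set points, [/\ line a, a x & a y];
  projspace_veblen : forall (x y z t : points) (xy zt xz yt : set points),
    x <> y -> z <> t -> x <> z -> y <> t ->
    line xy -> line zt -> line xz -> line yt ->
    xy x -> xy y -> zt z -> zt t -> xz x -> xz z -> yt y -> yt t ->
    xy `&` zt !=set0 -> xz `&` yt !=set0;
  projspace_thick : forall a : set points, line a ->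
    exists x y z : points,
      [/\ a x, a y & a z] /\ [/\ x <> y, x <> z & y <> z]
}.

Definition subspace (S : projspace) (M : set (points S)) : Prop :=
  forall (x y : points S) (a : set (points S)),
    x <> y -> M x -> M y -> line a -> a x -> a y -> a `<=` M.

Definition span (S : projspace) (A : set (points S)) : set (points S) :=
  smallest (@subspace S) A.

(* A basis of an [n]-dimensional space is an independent spanning family of
   [n.+1] points; independence makes the family injective. *)
Definition is_basis (S : projspace) (n : nat) (p : 'I_n.+1 -> points S) : Prop :=
  (forall i, ~ span (p @` [set j | j <> i]) (p i)) /\ span (range p) = setT.

Definition has_dim (S : projspace) (n : nat) : Prop :=
  exists p : 'I_n.+1 -> points S, is_basis p.

Definition intersecting (S : projspace) (a b : set (points S)) : Prop :=
  a <> b /\ a `&` b !=set0.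

Definition collineation (S S' : projspace) (k : points S -> points S') : Prop :=
  exists k' : points S' -> points S,
    [/\ cancel k k', cancel k' k,
        forall a, line a -> line (k @` a) &
        forall b, line b -> line (k' @` b)].

(* A map between line sets is represented by a map on arbitrary point sets,
   of which only the values at lines matter. *)
Definition stems_from (S S' : projspace)
    (f : set (points S) -> set (points S')) (k : points S -> points S') : Prop :=
  forall a, line a -> f a = k @` a.

(* Main.v *)
Require Import Defs.
From mathcomp Require Import all_boot.
From mathcomp Require Import mathcomp_extra boolp classical_sets functions.
From Stdlib Require List.

Local Open Scope classical_set_scope.

(** The lines through a point x are sent to pairwise distinct, pairwise
intersecting lines, and such a family is either concurrent or contained in a
plane ([pairwise_meeting_lines]). The second case is incompatible with
surjectivity: every line of S equals or meets a line through x, so every image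
line would meet the plane, although in dimension at least 4 some line misses it
([star_to_star]). Hence the images of the lines through x share a point k x;
in other words, f a contains k x for all x on a.

If k p = k r with p <> r, a point x off the line pr lies on two lines whose
images are distinct and contain both k x and k p, so that k x = k p; then k is
constant, and all lines of S' would pass through one point
([centre_map_inj]). Once k is injective, f a is the line spanned by the image
of a, and k preserves non-collinearity because intersecting lines have distinct
images; so k x lies on f a only if x lies on a ([centre_map_reflects]), which
gives the injectivity of f.

Surjectivity of k is the place where the equality of the two dimensions enters
([centre_map_surj]). If q is not of the form k x, take two lines f a and f b
through q. A common point of a and b would be sent to q, so a and b are skew,
and four points spanning them extend to n.+1 points that span S. The images of
these points span S'; but the first four images lie in the plane of f a and f b,
so S' is spanned by n points. Finally, f a is the full image of a under k, so k
is a collineation.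

The dimension theory used here rests on one consequence of the Veblen-Young
axiom, that a cone over a subspace is a subspace ([subspace_cone]); it yields
the exchange property and the lemma of Steinitz. *)

(** * Subspaces and cones *)

Lemma line_unique {S : projspace} {x y : points S} {a b : set (points S)} :
  x <> y -> line a -> line b -> a x -> a y -> b x -> b y -> a = b.
Proof.
move=> xy la lb ax ay bx b_y; have [c [_ cu]] := projspace_join xy.
by rewrite -(cu a) // -(cu b).
Qed.

Lemma line_through {S : projspace} {x y : points S} :
  x <> y -> exists a : set (points S), [/\ line a, a x & a y].
Proof. by move=> xy; have [c [? _]] := projspace_join xy; exists c. Qed.

Lemma subspace_span {S : projspace} (A : set (points S)) : subspace (span A).
Proof.
move=> x y a xy Ax Ay la ax ay z az M [sM AM].
by apply: (sM x y a) => //; [apply: Ax|apply: Ay].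
Qed.

Lemma span_gen {S : projspace} (A : set (points S)) : A `<=` span A.
Proof. by move=> x Ax M [_]; apply. Qed.

Lemma span_min {S : projspace} (A M : set (points S)) :
  subspace M -> A `<=` M -> span A `<=` M.
Proof. by move=> sM AM x; apply. Qed.

Lemma span_mono {S : projspace} (A B : set (points S)) :
  A `<=` B -> span A `<=` span B.
Proof.
move=> AB; apply: span_min; first exact: subspace_span.
by apply: subset_trans AB _; exact: span_gen.
Qed.

(** The union of the lines joining b to M; it is meant for b outside M, since for
b in M it contains every line through b. *)
Definition cone {S : projspace} (b : points S) (M : set (points S)) :=
  [set y | y = b \/ exists a z, [/\ line a, M z, a b, a z & a y]].

Lemma sub_cone {S : projspace} (b : points S) (M : set (points S)) :
  M `<=` cone b M.
Proof.
move=> y My; have [->|yb] := pselect (y = b); first by left.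
by right; have [a [la ay ab]] := line_through yb; exists a, y.
Qed.

(** Let x and y lie on the rulings bz1 and bz2, let w lie on the line xy, and let
m be the line z1z2 of M. The Veblen-Young axiom shows first that xy meets m, in
a point u, and then, on the triangle formed by bz1, xy and m, that the line bw
meets m: the ruling through w ends there. *)
Lemma subspace_cone {S : projspace} (b : points S) (M : set (points S)) :
  subspace M -> ~ M b -> subspace (cone b M).
Proof.
move=> sM Mb x y a xy Cx Cy la ax ay w aw.
have neb z : M z -> b <> z by move=> Mz bz; apply: Mb; rewrite bz.
(* A line through b that meets the cone again is one of its rulings. *)
have vertex v : v <> b -> cone b M v -> a b -> a v -> cone b M w.
  move=> vb [//|[l [z [ll Mz lb lz lv]]]] ab av; right; exists l, z.
  by split=> //; rewrite (line_unique vb ll la).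
have [eb|xb] := pselect (x = b).
  by apply: (vertex y) => //; rewrite -eb //; exact: nesym.
have [eb|yb] := pselect (y = b).
  by apply: (vertex x) => //; rewrite -eb.
have [-> |wb] := pselect (w = b); first by left.
have [ab|nab] := pselect (a b); first exact: (vertex x).
case: (Cx) => [//|[l1 [z1 [ll1 Mz1 l1b l1z l1x]]]].
case: (Cy) => [//|[l2 [z2 [ll2 Mz2 l2b l2z l2y]]]].
have z12 : z1 <> z2.
  move=> e; move: l2z; rewrite -e => l2z; apply: nab.
  have el := line_unique (neb _ Mz1) ll1 ll2 l1b l1z l2b l2z.
  by rewrite (line_unique xy la ll1) // el.
have [m [lm mz1 mz2]] := line_through z12.
have mM : m `<=` M by apply: (sM z1 z2 m).
(* The lines x z1 and y z2 meet in b, hence so do x y and z1 z2. *)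
have [u [au mu]] : a `&` m !=set0.
  have [e|xz1] := pselect (x = z1); first by exists x; split=> //; rewrite e.
  have [e|yz2] := pselect (y = z2); first by exists y; split=> //; rewrite e.
  apply: (projspace_veblen (x := x) (y := z1) (z := y) (t := z2)
    (xy := l1) (zt := l2)) => //.
  by exists b.
have [->|wu] := pselect (w = u); first exact/sub_cone/mM.
have [k [lk kb kw]] : exists k : set (points S), [/\ line k, k b & k w].
  exact/line_through/nesym.
(* The lines b z and w u meet in x or y, hence so do b w and z u = m; here z is
   whichever of z1 and z2 differs from u. *)
have [v [kv mv]] : k `&` m !=set0.
  have [e|z1u] := pselect (z1 = u).
    apply: (projspace_veblen (x := b) (y := z2) (z := w) (t := u)
      (xy := l2) (zt := a)) => //; first exact: neb.
    - exact: nesym.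
    - by rewrite -e; exact: nesym.
    - by exists y.
  apply: (projspace_veblen (x := b) (y := z1) (z := w) (t := u)
    (xy := l1) (zt := a)) => //; first exact: neb.
  - exact: nesym.
  - by exists x.
by right; exists k, v; split=> //; exact: mM.
Qed.

Lemma span_cone {S : projspace} (b : points S) (A : set (points S)) :
  ~ span A b -> span (b |` A) `<=` cone b (span A).
Proof.
move=> Ab; apply: span_min; first by apply: subspace_cone => //; exact: subspace_span.
move=> x [->|Ax]; first by left.
by apply: sub_cone; exact: span_gen.
Qed.

(** If b is not already in the span of A, then x lies on a line joining b to a
point z of that span, and this line also joins x to z. *)
Lemma span_exchange {S : projspace} (b x : points S) (A : set (points S)) :
  span (b |` A) x -> ~ span A x -> span (x |` A) b.
Proof.
move=> bAx Ax.
have Asub : span A `<=` span (x |` A) by apply: span_mono => y; right.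
have xin : span (x |` A) x by apply: span_gen; left.
have [/Asub//|Ab] := pselect (span A b).
case: (span_cone _ _ Ab _ bAx) => [<- //|[a [z [la Az ab az ax]]]].
have xz : x <> z by move=> e; apply: Ax; rewrite e.
by apply: (subspace_span _ x z a) => //; apply: Asub.
Qed.

(** * Exchange and dimension *)

Definition elts {T : Type} (s : seq T) : set T := [set x | List.In x s].

Lemma elts_cons {T : Type} (x : T) (s : seq T) : elts (x :: s) = x |` elts s.
Proof. by apply/seteqP; split=> y [->|]; [left|right|left|right]. Qed.

Lemma elts_cat {T : Type} (s t : seq T) : elts (s ++ t) = elts s `|` elts t.
Proof. by apply/seteqP; split=> y /List.in_app_iff. Qed.

(** Each point is compared only with the span of its successors; by the exchange
property this already amounts to independence of the family, and it suits
induction on the sequence. *)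
Fixpoint indep {S : projspace} (s : seq (points S)) : Prop :=
  if s is x :: s' then ~ span (elts s') x /\ indep s' else True.

(** As the suffixes of s grow, their spans with A contain x from some step on; the
element added at that step is the one that x replaces. *)
Lemma exchange_in_seq {S : projspace} (x : points S) (A : set (points S)) s :
  ~ span A x -> span (A `|` elts s) x ->
  exists2 s', size s = (size s').+1 &
    A `|` elts s `<=` span (x |` (A `|` elts s')).
Proof.
move=> Ax; elim: s => [|b s IHs].
  by rewrite (_ : elts [::] = set0) ?setU0 //; apply/seteqP; split.
have [/IHs[s' ss' sub] _|nAsx] := pselect (span (A `|` elts s) x).
  exists (b :: s'); rewrite /= ?ss' // !elts_cons => y.
  have mono : span (x |` (A `|` elts s')) `<=`
      span (x |` (A `|` (b |` elts s'))).
    apply: span_mono => z [->|[Az|sz]]; first by left.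
      by right; left.
    by right; right; right.
  case=> [Ay|[->|sy]].
  - by apply: mono; apply: sub; left.
  - by apply: span_gen; right; right; left.
  - by apply: mono; apply: sub; right.
rewrite elts_cons setUCA => bAsx; exists s => // y [->|Asy].
  exact: span_exchange.
by apply: span_gen; right.
Qed.

Lemma steinitz {S : projspace} (s t : seq (points S)) :
  indep s -> span (elts t) = setT ->
  exists2 t', size t' + size s = size t & span (elts (s ++ t')) = setT.
Proof.
elim: s => [_ tT|x s IHs]; first by exists t => //=; rewrite addn0.
case=> sx ind tT; have [t1 st1 spt1] := IHs ind tT.
have : span (elts s `|` elts t1) x by rewrite -elts_cat spt1.
case/(exchange_in_seq _ _ _ sx) => t' stt' sub.
exists t'; first by rewrite -st1 stt' /= addnS.
apply/seteqP; split=> // y _; rewrite /= elts_cons elts_cat.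
have : span (elts s `|` elts t1) y by rewrite -elts_cat spt1.
apply: span_min => //; exact: subspace_span.
Qed.

Lemma basis_spanning {S : projspace} {n : nat} :
  has_dim S n -> exists2 t : seq (points S), size t = n.+1 & span (elts t) = setT.
Proof.
case=> p [_ pT]; exists [seq p i | i <- enum 'I_n.+1].
  by rewrite size_map size_enum_ord.
apply/seteqP; split=> // x _; have : span (range p) x by rewrite pT.
apply: span_mono => _ [i _ <-]; apply: List.in_map.
have : i \in enum 'I_n.+1 by rewrite mem_enum.
by elim: (enum _) => //= j s IHs; rewrite inE => /orP[/eqP->|/IHs]; [left|right].
Qed.

Lemma basis_indep {S : projspace} {n : nat} :
  has_dim S n -> exists2 s : seq (points S), size s = n.+1 & indep s.
Proof.
case=> p [pI _]; exists [seq p i | i <- enum 'I_n.+1].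
  by rewrite size_map size_enum_ord.
have := enum_uniq 'I_n.+1; elim: (enum _) => //= i s IHs /andP[is_ /IHs ind].
split=> // spi; apply: (pI i); move: spi; apply: span_mono.
move=> x; rewrite /elts /= => /List.in_map_iff[j [<- js]]; exists j => //= ji.
move: is_; rewrite -ji => /negP; apply.
by elim: s js {IHs ind} => //= k s IHs [->|/IHs]; rewrite inE ?eqxx // => ->; rewrite orbT.
Qed.

Lemma spanning_size {S : projspace} {n : nat} (t : seq (points S)) :
  has_dim S n -> span (elts t) = setT -> n < size t.
Proof.
move=> /basis_indep[s ss ind] tT; have [t' e _] := steinitz _ _ ind tT.
by rewrite -e ss leq_addl.
Qed.

Lemma outside_point {S : projspace} {n : nat} (t : seq (points S)) :
  has_dim S n -> size t <= n -> exists x, ~ span (elts t) x.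
Proof.
move=> dS st; apply: contrapT => /forallNP all; have tT : span (elts t) = setT.
  by apply/seteqP; split=> // x _; apply: contrapT; exact: all.
by have := spanning_size t dS tT; rewrite ltnNge st.
Qed.

(** Join a point x outside the span M of t to a point y outside the span of M and
x: if the line xy met M, it would be contained in the span of M and x. *)
Lemma disjoint_line {S : projspace} {n : nat} (t : seq (points S)) :
  has_dim S n -> (size t).+1 <= n ->
  exists2 a : set (points S), line a & forall x, a x -> ~ span (elts t) x.
Proof.
move=> dS st; have [x tx] := outside_point _ dS (ltnW st).
have [y txy] := outside_point (x :: t) dS st.
have xy : x <> y by move=> e; apply: txy; rewrite -e; apply: span_gen; left.
have [a [la ax ay]] := line_through xy; exists a => // z az tz.
have zx : z <> x by move=> e; apply: tx; rewrite -e.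
apply: txy; apply: (subspace_span _ z x a) => //; last by apply: span_gen; left.
by apply: span_mono tz => u; right.
Qed.

Lemma two_points {S : projspace} (a : set (points S)) :
  line a -> exists x y, [/\ a x, a y & x <> y].
Proof. by case/projspace_thick=> x [y [z [[ax ay _] [xy _ _]]]]; exists x, y. Qed.

(** * Families of pairwise intersecting lines *)

(** Let a and b meet in q and let c avoid q, so that a, b and c form a triangle.
Any other line of the family meets all three sides, and does so in two different points: in q
and a point of c if it contains q, otherwise in points of a and b. *)
Lemma pairwise_meeting_lines {S : projspace} (F : set (set (points S))) :
  F `<=` @line S ->
  (forall a b, F a -> F b -> a <> b -> intersecting a b) ->
  (exists a b, [/\ F a, F b & a <> b]) ->
  (exists q, forall a, F a -> a q) \/
  (exists u v w, forall a, F a -> a `<=` span (elts [:: u; v; w])).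
Proof.
move=> Fl Fm [a [b [Fa Fb ab]]].
have [_ [q [aq bq]]] := Fm _ _ Fa Fb ab.
have [cq|] := pselect (forall c, F c -> c q); first by left; exists q.
move=> /existsNP[c /not_implyP[Fc ncq]]; right.
have ac : a <> c by move=> e; apply: ncq; rewrite -e.
have bc : b <> c by move=> e; apply: ncq; rewrite -e.
have [_ [u [au cu]]] := Fm _ _ Fa Fc ac.
have [_ [v [bv cv]]] := Fm _ _ Fb Fc bc.
have qu : q <> u by move=> e; apply: ncq; rewrite e.
have qv : q <> v by move=> e; apply: ncq; rewrite e.
have only_q x : a x -> b x -> x = q.
  move=> ax bx; apply: contrapT => xq.
  by apply: ab; apply: (line_unique xq) => //; exact: Fl.
have uv : u <> v by move=> e; apply: qu; rewrite (only_q u) // e.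
exists q, u, v; set E := span _.
have sE : subspace E by exact: subspace_span.
have Eq : E q by apply: span_gen; left.
have Eu : E u by apply: span_gen; right; left.
have Ev : E v by apply: span_gen; right; right; left.
have aE : a `<=` E by apply: (sE q u) => //; exact: Fl.
have bE : b `<=` E by apply: (sE q v) => //; exact: Fl.
have cE : c `<=` E by apply: (sE u v) => //; exact: Fl.
move=> d Fd.
have [->//|da] := pselect (d = a).
have [->//|db] := pselect (d = b).
have [->//|dc] := pselect (d = c).
have [dq|ndq] := pselect (d q).
  have [_ [w [dw cw]]] := Fm _ _ Fd Fc dc.
  apply: (sE q w) => //; [|exact: cE|exact: Fl].
  by move=> e; apply: ncq; rewrite e.
have [_ [s [ds as_]]] := Fm _ _ Fd Fa da.
have [_ [t [dt bt]]] := Fm _ _ Fd Fb db.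
apply: (sE s t) => //; [|exact: aE|exact: bE|exact: Fl].
by move=> e; apply: ndq; rewrite -(only_q s) // e.
Qed.

(** * The point map induced by the line map *)

Section LineMap.
Context {n : nat} {S S' : projspace}.
Variable f : set (points S) -> set (points S').
Hypotheses (dimS : has_dim S n) (dimS' : has_dim S' n).
Hypothesis f_fun : set_fun (@line S) (@line S') f.
Hypothesis f_surj : set_surj (@line S) (@line S') f.
Hypothesis f_int : forall a b : set (points S), line a -> line b ->
  intersecting a b -> intersecting (f a) (f b).

(** Were the images of the lines through x contained in the span of three points,
every image line would meet that span, because every line of S is either a line
through x or meets one in a further point. *)
Lemma star_to_star (hn : 4 <= n) (x : points S) :
  exists q, forall a, line a -> a x -> f a q.
Proof.
pose F := [set f a | a in [set a | line a /\ a x]].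
have [||||] := @pairwise_meeting_lines S' F.
- by move=> _ [a [la _] <-]; exact: f_fun.
- move=> _ _ [a [la ax] <-] [b [lb bx] <-] fab.
  by apply: f_int => //; split; [move=> e; apply: fab; rewrite e|exists x].
- have [y xy] : exists y, x <> y.
    have [y ny] := @outside_point _ _ [:: x] dimS (leq_trans (isT : 1 <= 4) hn).
    by exists y => e; apply: ny; rewrite e; apply: span_gen; left.
  have [a [la ax ay]] := line_through xy.
  have [z nz] := @outside_point _ _ [:: x; y] dimS (leq_trans (isT : 2 <= 4) hn).
  have xz : x <> z by move=> e; apply: nz; rewrite -e; apply: span_gen; left.
  have [b [lb bx bz]] := line_through xz.
  have ab : a <> b.
    move=> e; apply: nz; rewrite -e in bz.
    apply: (subspace_span _ x y a) => //; apply: span_gen; first by left.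
    by right; left.
  exists (f a), (f b); split; [by exists a|by exists b|].
  by have [] := f_int a b la lb (conj ab (ex_intro _ x (conj ax bx))).
- by move=> [q Fq]; exists q => a la ax; apply: Fq; exists a.
move=> [u [v [w Fuvw]]]; exfalso.
have [h' lh' h'uvw] := @disjoint_line _ _ [:: u; v; w] dimS' hn.
have [h lh fh] := f_surj _ lh'.
have sub a : line a -> a x -> f a `<=` span (elts [:: u; v; w]).
  by move=> la ax; apply: Fuvw; exists a.
have nhx : ~ h x.
  move=> hx; have [y [_ [h'y _ _]]] := two_points _ lh'.
  by apply: (h'uvw y h'y); apply: (sub h) => //; rewrite fh.
have [y [_ [hy _ _]]] := two_points _ lh.
have xy : x <> y by move=> e; apply: nhx; rewrite e.
have [a [la ax ay]] := line_through xy.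
have ah : a <> h by move=> e; apply: nhx; rewrite -e.
have [_ [z [az hz]]] := f_int a h la lh (conj ah (ex_intro _ y (conj ay hy))).
by apply: (h'uvw z); [rewrite -fh|exact: (sub a)].
Qed.

Section CentreMap.
Variable k : points S -> points S'.
Hypothesis kP : forall x a, line a -> a x -> f a (k x).

(** If k takes one value at two points, it takes this value at every point off
their line, and then, using a point off the line as one of the two, everywhere;
so some point would be on all lines of S'. *)
Lemma centre_map_inj (hn : 2 <= n) : injective k.
Proof.
move=> p r kpr; apply: contrapT => pr.
have spread (p' r' x : points S) a : p' <> r' -> k p' = k r' -> line a ->
    a p' -> a r' -> ~ a x -> k x = k p'.
  move=> pr' e la ap ar nax.
  have xp : x <> p' by move=> ex; apply: nax; rewrite ex.
  have xr : x <> r' by move=> ex; apply: nax; rewrite ex.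
  have [b [lb bx bp]] := line_through xp.
  have [c [lc cx cr]] := line_through xr.
  have bc : b <> c.
    move=> ebc; apply: nax; rewrite -ebc in cr.
    by rewrite (line_unique pr' la lb).
  have [nfbc _] := f_int b c lb lc (conj bc (ex_intro _ x (conj bx cx))).
  apply: contrapT => ne; apply: nfbc; apply: (line_unique ne); try exact: f_fun.
  - exact: kP.
  - exact: kP.
  - exact: kP.
  - by rewrite e; exact: kP.
have [a [la ap ar]] := line_through pr.
have const x : k x = k p.
  have [ax|] := pselect (a x); last exact: (spread p r x a).
  have [->//|xp] := pselect (x = p).
  have [y ny] := @outside_point _ _ [:: p; r] dimS hn.
  have nay : ~ a y.
    move=> ay; apply: ny; apply: (subspace_span _ p r a) => //.
      by apply: span_gen; left.
    by apply: span_gen; right; left.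
  have py : p <> y by move=> e; apply: nay; rewrite -e.
  have [b [lb bp b_y]] := line_through py.
  apply: (spread p y x b) => //; first by rewrite (spread p r y a).
  by move=> bx; apply: nay; rewrite (line_unique xp la lb).
have [h' lh' h'p] := @disjoint_line _ _ [:: k p] dimS' hn.
have [h lh fh] := f_surj _ lh'; have [y [_ [hy _ _]]] := two_points _ lh.
apply: (h'p (k p)); last by apply: span_gen; left.
by rewrite -fh -(const y); exact: kP.
Qed.

Hypothesis k_inj : injective k.

(** If k x is on f a while x is off a, the lines joining x to two points of a
intersect in x, yet f sends both of them to f a. *)
Lemma centre_map_reflects (x : points S) a : line a -> f a (k x) -> a x.
Proof.
move=> la fax; apply: contrapT => nax.
have [y [z [ay az yz]]] := two_points _ la.
have xy : x <> y by move=> e; apply: nax; rewrite e.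
have xz : x <> z by move=> e; apply: nax; rewrite e.
have [b [lb bx b_y]] := line_through xy.
have [c [lc cx cz]] := line_through xz.
have bc : b <> c.
  by move=> e; apply: nax; rewrite -e in cz; rewrite (line_unique yz la lb).
have [fbc _] := f_int b c lb lc (conj bc (ex_intro _ x (conj bx cx))).
have toa (v : points S) d : line d -> d x -> d v -> a v -> x <> v -> f d = f a.
  move=> ld dx dv av xv.
  have kxv : k x <> k v by move/k_inj.
  by apply: (line_unique kxv); try exact: kP; try exact: f_fun.
by apply: fbc; rewrite (toa y b) // (toa z c).
Qed.

Lemma line_map_inj : set_inj (@line S) f.
Proof.
move=> a b /set_mem la /set_mem lb fab.
have [y [z [ay az yz]]] := two_points _ la.
by apply: (line_unique yz) => //; apply: centre_map_reflects => //;
  rewrite -fab; exact: kP.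
Qed.

(** Preimages of subspaces under k are subspaces, so the span of k t contains the
image of k; and every line of S', being some f a, contains two points of it. *)
Lemma centre_map_span (t : seq (points S)) (hn : 1 <= n) :
  span (elts t) = setT -> span (elts (map k t)) = setT.
Proof.
move=> tT; set M := span _.
have Mk x : M (k x).
  have : span (elts t) x by rewrite tT.
  apply: (@span_min _ _ (k @^-1` M)).
    move=> y z a yz My Mz la ay az w aw.
    have kyz : k y <> k z by move/k_inj.
    by apply: (subspace_span _ (k y) (k z) (f a)) => //; try exact: kP; exact: f_fun.
  by move=> y ty; apply: span_gen; exact: List.in_map.
apply/seteqP; split=> // q _.
have [r nr] := @outside_point _ _ [:: q] dimS' hn.
have qr : q <> r by move=> e; apply: nr; rewrite -e; apply: span_gen; left.
have [a' [la' a'q a'r]] := line_through qr.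
have [a la fa] := f_surj _ la'.
have [y [z [ay az yz]]] := two_points _ la.
have kyz : k y <> k z by move/k_inj.
have [fay faz] : f a (k y) /\ f a (k z) by split; exact: kP.
by rewrite fa in fay faz; apply: (subspace_span _ (k y) (k z) a') => //; exact: Mk.
Qed.

(** Two lines f a and f b through a point q that k misses come from skew lines a
and b. Four independent points x1, x2 on a and y1, y2 on b belong to a spanning
family of n.+1 points of S, but their images lie in the plane of q, k x1 and
k y1, so that n points span S'. *)
Lemma centre_map_surj (hn : 2 <= n) (q : points S') : exists x, k x = q.
Proof.
apply: contrapT => nq.
have nkq x : k x <> q by move=> e; apply: nq; exists x.
have [r nr] := @outside_point _ _ [:: q] dimS' (ltnW hn).
have qr : q <> r by move=> e; apply: nr; rewrite -e; apply: span_gen; left.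
have [a' [la' a'q a'r]] := line_through qr.
have [s ns] := @outside_point _ _ [:: q; r] dimS' hn.
have qs : q <> s by move=> e; apply: ns; rewrite -e; apply: span_gen; left.
have [b' [lb' b'q b's]] := line_through qs.
have ab' : a' <> b'.
  move=> e; apply: ns; rewrite -e in b's.
  apply: (subspace_span _ q r a') => //; apply: span_gen; first by left.
  by right; left.
have [a la fa] := f_surj _ la'; have [b lb fb] := f_surj _ lb'.
have skew x : a x -> ~ b x.
  move=> ax bx; apply: ab'; apply: (line_unique (nkq x)) => //.
    by rewrite -fa; exact: kP.
  by rewrite -fb; exact: kP.
have [x1 [x2 [ax1 ax2 x12]]] := two_points _ la.
have [y1 [y2 [by1 by2 y12]]] := two_points _ lb.
have span_a : span (elts [:: x2; x1]) `<=` a.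
  apply: span_min; last by move=> z [<-|[<-|]].
  by move=> u v c uv au av lc cu cv; rewrite (line_unique uv lc la).
have ind : indep [:: y2; y1; x2; x1].
  split; last split; last split; last split=> //.
  (* Otherwise y2 is on the cone over a with vertex y1, and the ruling through
     y2, which is b, meets a. *)
  - have ny1 : ~ span (elts [:: x2; x1]) y1 by move/span_a=> ay1; exact: (skew y1).
    rewrite elts_cons => /(span_cone _ _ ny1)[/esym//|[c [z [lc Mz cy1 cz cy2]]]].
    apply: (skew z (span_a _ Mz)).
    by rewrite (line_unique y12 lb lc).
  - by move/span_a=> ay1; exact: (skew y1).
  - have : subspace [set x1].
      by move=> u v c uv /= eu ev; case: uv; rewrite eu ev.
    move=> sx /(@span_min _ _ _ sx) e.
    by apply: x12; symmetry; apply: e => z [<-|].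
  - move/(@span_min _ _ set0) => e; apply: e => //.
have [t st tT] := basis_spanning dimS.
have [t' st' spT] := steinitz _ _ ind tT.
have := centre_map_span _ (ltnW hn) spT.
set M := span _ => MT.
(* The points q, k x1 and k y1 replace the images of the four points. *)
suff : n < size [:: q, k x1, k y1 & map k t'].
  by rewrite /= size_map; move: st'; rewrite st /= !addnS addn0 => -[<-]; rewrite ltnn.
apply: (spanning_size _ dimS'); apply/seteqP; split=> // z _.
have : M z by rewrite MT.
set N := span _; have sN : subspace N by exact: subspace_span.
have Nq : N q by apply: span_gen; left.
have Nx1 : N (k x1) by apply: span_gen; right; left.
have Ny1 : N (k y1) by apply: span_gen; right; right; left.
apply: span_min => // u [<-|[<-|[<-|[<-|ut]]]] //.
- apply: (sN (k y1) q b') => //; rewrite -fb; exact: kP.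
- apply: (sN (k x1) q a') => //; rewrite -fa; exact: kP.
- by apply: span_gen; right; right; right.
Qed.

Lemma centre_map_image (k_surj : forall q, exists x, k x = q) a :
  line a -> f a = k @` a.
Proof.
move=> la; apply/seteqP; split=> [q faq|_ [x ax <-]]; last exact: kP.
have [x kx] := k_surj q; exists x => //.
by apply: centre_map_reflects => //; rewrite kx.
Qed.

End CentreMap.
End LineMap.

Theorem mainTheorem4 (n : nat) (S S' : projspace)
    (f : set (points S) -> set (points S'))
    (hn : 4 <= n) (dimS : has_dim S n) (dimS' : has_dim S' n)
    (f_fun : set_fun (@line S) (@line S') f)
    (f_surj : set_surj (@line S) (@line S') f)
    (f_int : forall a b : set (points S), line a -> line b ->
      intersecting a b -> intersecting (f a) (f b)) :
  set_inj (@line S) f /\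
  exists k : points S -> points S', collineation k /\ stems_from f k.
Proof.
have /choice[k kP] := star_to_star f dimS dimS' f_fun f_surj f_int hn.
have hn2 : 2 <= n by exact: leq_trans hn.
have k_inj := centre_map_inj f dimS dimS' f_fun f_surj f_int k kP hn2.
have k_surj := centre_map_surj f dimS dimS' f_fun f_surj k kP k_inj hn2.
have fE := centre_map_image f f_fun f_int k kP k_inj k_surj.
split; first exact: line_map_inj kP k_inj.
exists k; split=> //; have /choice[k' kk'] := k_surj.
have k'k : cancel k k' by move=> x; apply: k_inj.
exists k'; split=> // [a la|b lb]; first by rewrite -fE //; exact: f_fun.
have [a la <-] := f_surj _ lb; rewrite fE // image_comp.
rewrite (_ : _ @` a = a) //.
apply/seteqP; split=> [_ [x ax <-]|x ax]; first by rewrite /= k'k.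
by exists x => //=.
Qed.
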